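(* Let $S=[0,\infty]$, let $\hat P\in\mathcal{P}(S)$, and let $x_0\geq 0$ be such that $p_x:=\hat P((x,\infty))>0$ for all $x\geq x_0$ and $\lim_{x\to\infty}p_x=0$. Let $f:(0,\infty)\to\mathbb{R}$ be convex with $f(1)=0$ and satisfy: $f$ is continuously differentiable and strictly convex, $f'(1)=0$, and $f|_{[1,\infty)}$ is nonnegative, increasing and regularly varying at infinity with some index $\rho\geq 1$. Let $0<\delta<f^*(0)+f(0)$, and put $$\mathcal{P}_f(\delta)=\{P\in\mathcal{P}(S):\ P\ll\hat P,\ D_f(P\Vert\hat P)\leq\delta\},\qquad \overline{F}^*_f(x)=\sup\{P((x,\infty)):\ P\in\mathcal{P}_f(\delta)\}.$$ Then, as $x\to\infty$: (1) if $f^*(0)=\infty$, then $\overline{F}^*_f(x)\sim f^{\leftarrow}(\delta/p_x)\,p_x$; (2) if $f^*(0)\in(0,\infty)$, then $\overline{F}^*_f(x)\sim \ell\in(0,1]$, where $\ell$ is the unique root of the equation $\ell f^*(0)+f(1-\ell)=\delta$. Here $f^{\leftarrow}(y):=\inf\{z\geq 1:\ f(z)\geq y\}$.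
   Context: $\mathcal{P}(S)$ is the set of Borel probability measures on $S$. For $P\ll Q$, the $f$-divergence is $D_f(P\Vert Q)=\mathbb{E}_Q[f(dP/dQ)]$. By convention $f(0):=\lim_{y\to0^+}f(y)\in(-\infty,\infty]$. The $*$-conjugate of $f$ is $f^*(y)=y f(1/y)$, $y\in(0,\infty)$, and $f^*(0):=\lim_{y\to0^+}f^*(y)=\lim_{y\to\infty}f(y)/y\in(-\infty,\infty]$. A function $h$ that is measurable and positive for all large arguments is regularly varying at infinity with index $\rho$ if $\lim_{x\to\infty}h(tx)/h(x)=t^\rho$ for all $t>0$. The notation $a(x)\sim b(x)$ means $a(x)/b(x)\to1$ as $x\to\infty$. *)

(* Defs.v *)
From HB Require Import structures.
From mathcomp Require Import all_boot all_order all_algebra.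
From mathcomp Require Import all_classical all_reals all_analysis.
From mathcomp Require Import measurable_realfun.

Set Implicit Arguments.
Unset Strict Implicit.
Unset Printing Implicit Defensive.

Import Order.TTheory GRing.Theory Num.Theory.
Import numFieldNormedType.Exports.

Local Open Scope classical_set_scope.
Local Open Scope charge_scope.
Local Open Scope ring_scope.

(** The space [[0, +oo]], endpoint [+oo] included.  Its Borel sigma-algebra is
    the trace of the Borel sigma-algebra of [\bar R]: the measurable sets are
    the preimages of those of [\bar R] under the inclusion. *)
Section nonneg_ereal.
Variable R : realType.

Definition nonneg_ereal_carrier := {x : \bar R | (0 <= x)%E}.

HB.instance Definition _ := Choice.on nonneg_ereal_carrier.
HB.instance Definition _ := isPointed.Build nonneg_ereal_carrier
  (exist (fun x : \bar R => is_true (0 <= x)%E) 0%E (lexx 0%E)).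

Definition nonneg_ereal_val (x : nonneg_ereal_carrier) : \bar R := sval x.

Definition nonneg_ereal :=
  @g_sigma_algebra_preimageType _ nonneg_ereal_carrier (\bar R)
    nonneg_ereal_val.

End nonneg_ereal.

(** Functions [(0, +oo) -> R] are represented by total functions [R -> R] whose
    values outside [(0, +oo)] are never used. *)
Section f_divergence.
Variable R : realType.
Implicit Types f h : R -> R.

(** The value [f(0)], possibly [+oo]. *)
Definition value0 f : \bar R := lim ((f y)%:E @[y --> 0^'+]).

(** [f^*]; the quantity [f^*(0)] is [value0 (star_conjugate f)]. *)
Definition star_conjugate f : R -> R := fun y => y * f y^-1.

(** [f] on [[0, +oo)].  Negative [x] are given the value [f(0)]; as a density
    is negative on a null set only, this choice has no effect on
    [f_divergence]. *)
Definition extend0 f (x : R) : \bar R :=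
  if 0 < x then (f x)%:E else value0 f.

(** [D_f(P || Q)], meaningful for [P `<< Q]. *)
Definition f_divergence f d (T : measurableType d) (P Q : probability T R) :
    \bar R :=
  (\int[Q]_x extend0 f
    (fine ('d (charge_of_finite_measure P) '/d Q x)))%E.

Definition f_ball f d (T : measurableType d) (Q : probability T R) (delta : R) :
    set (probability T R) :=
  [set P : probability T R | P `<< Q /\ (f_divergence f P Q <= delta%:E)%E].

Definition strictly_convex_pos f :=
  forall x y t : R, 0 < x -> 0 < y -> x != y -> 0 < t < 1 ->
    f (t * x + (1 - t) * y) < t * f x + (1 - t) * f y.

Definition continuously_derivable_pos f :=
  forall x : R, 0 < x -> derivable f x 1 /\ {for x, continuous (derive1 f)}.

Definition regularly_varying h (rho : R) :=
  (exists A : R, measurable_fun `]A, +oo[ h /\ forall x, A < x -> 0 < h x) /\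
  forall t : R, 0 < t -> h (t * x) / h x @[x --> +oo] --> t `^ rho.

Definition asymp (a b : R -> R) := a x / b x @[x --> +oo] --> (1 : R).

(** The infimum is taken in [R]; it is meaningful when [y] is at most some value
    of [f] on [[1, +oo)]. *)
Definition generalized_inverse f (y : R) : R := inf [set z | 1 <= z /\ y <= f z].

(** [P((x, +oo))]; the point [+oo] is excluded. *)
Definition tail (P : probability (nonneg_ereal R) R) (x : R) : R :=
  fine (P [set y | (x%:E < nonneg_ereal_val y < +oo)%E]).

(** A supremum of numbers of [[0, 1]], over a nonempty set as soon as [Q]
    belongs to the ball. *)
Definition worst_tail f (Q : probability (nonneg_ereal R) R) (delta x : R) : R :=
  sup [set tail P x | P in f_ball f Q delta].

End f_divergence.

(* Main.v *)
Require Import Defs.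
From HB Require Import structures.
From mathcomp Require Import all_boot all_order all_algebra.
From mathcomp Require Import all_classical all_reals all_analysis.
From mathcomp Require Import measurable_realfun ring lra.

Set Implicit Arguments.
Unset Strict Implicit.
Unset Printing Implicit Defensive.

Import Order.TTheory GRing.Theory Num.Theory.
Import numFieldNormedType.Exports.

Local Open Scope classical_set_scope.
Local Open Scope ring_scope.

(** Write [p] for [tail Phat x] and [c] for [f^*(0)], the limit slope of [f].
    The assumptions make [f] nonnegative, with its minimum [0] at [1].

    Why the theorem is true.  An adversary who moves mass [q] to [(x, +oo)] does
    so most cheaply with a density that is constant on this set and on its
    complement; the cost is [p f(q/p) + (1-p) f((1-q)/(1-p))].  As [p] tends to
    [0], the first term governs how large [q] can be when [c] is infinite, which
    gives [f(q/p) ~ delta/p]; when [c] is finite, the two terms tend to [q c] and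
    [f(1-q)], which gives the equation of [l].

    Lower bounds come from this two-valued density
    ([two_valued_f_divergence]).  Since [f] decreases on [(0, 1]], the second
    term is at most [f(1-q)], so [q] is reached as soon as
    [p f(q/p) + f(1-q) <= delta] ([worst_tail_ge]).  For finite [c] the choice
    [q = l] works exactly, because [f(y) <= c y] for [y >= 1].  For infinite [c],
    with [z] the generalized inverse of [f] at [delta/p], one takes
    [q/p = (1-e) z + e]: convexity and [f(1) = 0] save the proportion [e] of
    [delta], which pays for [f(1-q)], as [q] tends to [0].

    Upper bounds use no optimality of two-valued densities, only tangents.  If
    affine functions [m1 + s1 y] and [m2 + s2 y] lie below [f], integrating the
    first over [(x, +oo)] and the second over its complement bounds the
    divergence from below by an affine function of [P((x, +oo))]
    ([f_divergence_ge_affine]).  For infinite [c] the tangent at [z] on the tail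
    and [0] elsewhere give exactly [P((x, +oo)) <= p z].  For finite [c] a
    tangent at a far point, of slope almost [c], and the tangent at [1 - l] give
    [c (P((x, +oo)) - l) <= o(1)]. *)

(** * Values at the origin of a function nonincreasing on (0, 1] *)

(** [value0] is a bare limit; monotonicity is what makes it meaningful, and turns
    it into a supremum.  This is applied both to [f] and to its conjugate. *)
Lemma value0_nonincreasing (R : realType) (g : R -> R) :
  (forall x y : R, 0 < x -> x <= y -> y <= 1 -> g y <= g x) ->
  value0 g = ereal_sup ((EFin \o g) @` [set` `]0, 1]]).
Proof.
move=> g_decr; apply/cvg_lim => //.
apply: (@nonincreasing_at_right_cvge R (EFin \o g) 0 (BRight 1)).
  by rewrite bnd_simp.
move=> x y; rewrite !in_itv /= => /andP[x0 _] /andP[_ y1] xy.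
by rewrite lee_fin g_decr.
Qed.

Lemma value0_ub (R : realType) (g : R -> R) (y : R) :
  (forall x y : R, 0 < x -> x <= y -> y <= 1 -> g y <= g x) ->
  0 < y -> y <= 1 -> ((g y)%:E <= value0 g)%E.
Proof.
move=> g_decr y0 y1; rewrite value0_nonincreasing//; apply: ereal_sup_ubound.
by exists y => //=; rewrite in_itv/= y0.
Qed.

Lemma value0_gt (R : realType) (g : R -> R) (r : \bar R) :
  (forall x y : R, 0 < x -> x <= y -> y <= 1 -> g y <= g x) ->
  (r < value0 g)%E -> exists y, [/\ 0 < y, y <= 1 & (r < (g y)%:E)%E].
Proof.
move=> g_decr; rewrite value0_nonincreasing// => /ereal_sup_gt[_ [y + <-] ry].
by rewrite /= in_itv/= => /andP[y0 y1]; exists y.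
Qed.

(** * Strictly convex generators of divergences *)

Lemma convex_of_strict (R : realType) (f : R -> R) (x y t : R) :
  strictly_convex_pos f -> 0 < x -> 0 < y -> 0 <= t <= 1 ->
  f (t * x + (1 - t) * y) <= t * f x + (1 - t) * f y.
Proof.
move=> f_strict x0 y0 /andP[]; rewrite le_eqVlt => /predU1P[<- _|t0].
  by rewrite !mul0r !add0r subr0 !mul1r.
rewrite le_eqVlt => /predU1P[->|t1]; first by rewrite subrr !mul0r !addr0 !mul1r.
have [->|xy] := eqVneq x y; first by rewrite -!mulrDl addrC subrK !mul1r.
by apply/ltW/f_strict => //; rewrite t0.
Qed.

(** The difference quotients of [f] at [a] in the direction [y - a] are at most
    [f y - f a] for steps in [(0, 1)], by convexity; the directional derivative is
    their limit from the right. *)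
Lemma tangent_le (R : realType) (f : R -> R) (a y : R) :
  strictly_convex_pos f -> derivable f a 1 -> 0 < a -> 0 < y ->
  f a + derive1 f a * (y - a) <= f y.
Proof.
move=> f_strict df a0 y0; set v := y - a.
have fa : differentiable f a by exact/derivable1_diffP.
have Dv : 'D_v f a = derive1 f a * v.
  have vE : v = v *: (1 : R) by rewrite /GRing.scale/= mulr1.
  by rewrite derive1E !deriveE// {1}vE linearZ/= mulrC.
have : derivable f a v by exact: diff_derivable.
rewrite -lerBrDl -Dv => /cvg_dnbhs_at_right dv.
rewrite /derive -(cvg_lim _ dv)//.
apply: limr_le; first by apply/cvg_ex; eexists; exact: dv.
near=> h.
have h0 : 0 < h by near: h; exact: nbhs_right_gt.
have h1 : h < 1 by near: h; exact: nbhs_right_lt.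
rewrite /GRing.scale/= ler_pdivrMl//.
have -> : h * v + a = h * y + (1 - h) * a by rewrite /v; ring.
have := @convex_of_strict _ f y a h f_strict y0 a0.
rewrite (ltW h0) (ltW h1) => /(_ isT); lra.
Unshelve. all: by end_near. Qed.

Section divergence_generator.
Context (R : realType) (f : R -> R).
Hypotheses (f_strict : strictly_convex_pos f) (f1 : f 1 = 0).
Hypotheses (f_C1 : continuously_derivable_pos f) (df1 : derive1 f 1 = 0).

Lemma generator_tangent (a y : R) : 0 < a -> 0 < y ->
  f a + derive1 f a * (y - a) <= f y.
Proof. by move=> a0; apply: tangent_le => //; exact: (f_C1 a0).1. Qed.

Lemma generator_ge0 (x : R) : 0 < x -> 0 <= f x.
Proof.
by move=> x0; have := generator_tangent ltr01 x0; rewrite f1 df1 mul0r addr0.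
Qed.

(** A point of [(0, 1]] lies between any smaller one and the minimizer [1],
    and the chord joining their values stays below the value at the smaller one. *)
Lemma generator_decr (x y : R) : 0 < x -> x <= y -> y <= 1 -> f y <= f x.
Proof.
move=> x0 xy y1; have [x1|x1] := ltP x 1; last first.
  by have -> : x = y by lra.
pose t := (1 - y) / (1 - x).
have d0 : 0 < 1 - x by lra.
have t01 : 0 <= t <= 1.
  by rewrite /t ler_pdivrMr// mul1r divr_ge0/=; lra.
have -> : y = t * x + (1 - t) * 1 by rewrite /t; field; lra.
apply: le_trans (convex_of_strict f_strict x0 ltr01 t01) _.
rewrite f1 mulr0 addr0 ler_piMl ?generator_ge0//; by case/andP: t01.
Qed.

(** The slopes of the chords from [(1, 0)] increase; denominators are cleared so
    that [z = 1] and [w = 1] are covered. *)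
Lemma generator_chord (z w : R) : 1 <= z -> z <= w -> f z * (w - 1) <= (z - 1) * f w.
Proof.
move=> z1 zw; have [w1|w1] := eqVneq w 1.
  have -> : z = 1 by lra.
  by rewrite f1 mul0r subrr mul0r.
have d0 : 0 < w - 1 by rewrite subr_gt0 lt_neqAle eq_sym w1/=; lra.
pose t := (z - 1) / (w - 1).
have t01 : 0 <= t <= 1.
  by rewrite /t ler_pdivrMr// mul1r divr_ge0/=; lra.
have w0 : 0 < w by lra.
rewrite -ler_pdivlMr// -mulrAC -/t.
have {1}-> : z = t * w + (1 - t) * 1 by rewrite /t; field; lra.
apply: le_trans (convex_of_strict f_strict w0 ltr01 t01) _.
by rewrite f1 mulr0 addr0.
Qed.

Lemma generator_incr (z w : R) : 1 <= z -> z <= w -> f z <= f w.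
Proof.
move=> z1; rewrite le_eqVlt => /predU1P[->//|zw].
have d0 : 0 < w - 1 by lra.
rewrite -(ler_pM2r d0); apply: le_trans (generator_chord z1 (ltW zw)) _.
rewrite [leRHS]mulrC ler_wpM2r ?generator_ge0//; lra.
Qed.

Lemma generator_incr_strict (z w : R) :
  1 <= z -> z < w -> 0 < f w -> f z < f w.
Proof.
move=> z1 zw fw; have d0 : 0 < w - 1 by lra.
rewrite -(ltr_pM2r d0); apply: le_lt_trans (generator_chord z1 (ltW zw)) _.
by rewrite [ltRHS]mulrC ltr_pM2r//; lra.
Qed.

(** [f(z)/z] increases for [z >= 1]: it vanishes at [1] and beyond it is the chord
    slope [f(z)/(z-1)] times [1 - 1/z], a product of nonnegative increasing
    factors. *)
Lemma star_conjugate_decr (x y : R) : 0 < x -> x <= y -> y <= 1 ->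
  star_conjugate f y <= star_conjugate f x.
Proof.
move=> x0 xy y1; rewrite /star_conjugate; have y0 : 0 < y by lra.
have z1 : 1 <= y^-1 by rewrite invf_ge1.
have zw : y^-1 <= x^-1 by rewrite lef_pV2.
have := generator_chord z1 zw.
have : 0 <= f x^-1 by rewrite generator_ge0 ?invr_gt0.
have : 0 <= f y^-1 by rewrite generator_ge0 ?invr_gt0.
set a := f y^-1; set b := f x^-1 => a0 b0 ab.
have [x1|x1] := ltP x 1; last first.
  have xx : x = y by lra.
  by rewrite /a /b xx.
have {}ab : a * (1 - x) * y <= b * (1 - y) * x.
  have /(ler_wpM2l (ltW (mulr_gt0 x0 y0))) := ab.
  have -> : x * y * (a * (x^-1 - 1)) = a * (1 - x) * y by field; lra.
  by have -> : x * y * ((y^-1 - 1) * b) = b * (1 - y) * x by field; lra.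
have d0 : 0 < 1 - x by lra.
rewrite -(ler_pM2r d0).
apply: le_trans (_ : b * (1 - y) * x <= _).
  by rewrite [leLHS](_ : _ = a * (1 - x) * y)//; ring.
rewrite [leRHS](_ : _ = b * (1 - x) * x); last by ring.
by rewrite ler_wpM2r ?ler_wpM2l//; lra.
Qed.

Lemma generator_le_slope (c z : R) :
  value0 (star_conjugate f) = c%:E -> 1 <= z -> f z <= c * z.
Proof.
move=> cE z1; have z0 : 0 < z by lra.
have := @value0_ub _ _ z^-1 star_conjugate_decr.
rewrite invr_gt0 z0 invf_le1// z1 => /(_ isT isT).
by rewrite cE lee_fin /star_conjugate invrK ler_pdivrMl// mulrC.
Qed.

(** Chord slopes from [(1, 0)] increase to [c], which improves the bound [c z] to
    [c (z - 1)].  The gain makes [l' c + f(1 - l')] nonpositive for negative [l'],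
    so that no root is negative. *)
Lemma generator_le_slope_sub1 (c z : R) :
  value0 (star_conjugate f) = c%:E -> 1 <= z -> f z <= c * (z - 1).
Proof.
move=> cE z1; rewrite leNgt; apply/negP => H.
pose d := f z - c * (z - 1).
have d0 : 0 < d by rewrite /d subr_gt0.
(* Comparing the chords to [z] and to [w] yields [d * w <= f z], which fails for
   this [w]. *)
pose w := z + f z / d + 1.
have fz0 : 0 <= f z by apply: generator_ge0; lra.
have q0 : 0 <= f z / d by rewrite divr_ge0// ltW.
have zw : z <= w by rewrite /w; lra.
have w1 : 1 <= w by lra.
have A := generator_chord z1 zw.
have B := generator_le_slope cE w1; clear cE.
have z10 : 0 <= z - 1 by lra.
have C := ler_wpM2l z10 B.
have : d * w <= f z by rewrite /d; lra.
have E : d * (f z / d) = f z by field; lra.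
rewrite /w !mulrDr E mulr1.
have : 0 < d * z by rewrite mulr_gt0//; lra.
lra.
Qed.

Lemma generator_slope_gt (r : R) : (r%:E < value0 (star_conjugate f))%E ->
  exists2 z, 1 <= z & forall w, z <= w -> r * w < f w.
Proof.
move=> /(value0_gt star_conjugate_decr)[y [y0 y1 ry]].
exists y^-1 => [|w yw]; first by rewrite invf_ge1.
have w1 : 1 <= w by apply: le_trans yw; rewrite invf_ge1.
have w0 : 0 < w by lra.
rewrite -ltr_pdivlMr// mulrC.
move: ry; rewrite lte_fin => /lt_le_trans; apply.
have := @star_conjugate_decr w^-1 y.
by rewrite {2}/star_conjugate invrK invr_gt0 w0 y1 invf_ple//; apply.
Qed.

Lemma extend0_ge0 (x : R) : (0 <= extend0 f x)%E.
Proof.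
rewrite /extend0; case: ifPn => [x0|_]; first by rewrite lee_fin generator_ge0.
apply: le_trans (value0_ub generator_decr ltr01 (lexx 1)).
by rewrite f1.
Qed.

(** Densities may vanish, so affine minorants of [f] have to be extended to [0],
    where the value of [f] is only a limit. *)
Lemma extend0_ge_affine (m s : R) : (forall x : R, 0 < x -> m + s * x <= f x) ->
  forall x : R, 0 <= x -> ((m + s * x)%:E <= extend0 f x)%E.
Proof.
move=> ms x; rewrite le_eqVlt /extend0 => /predU1P[<-|x0]; last first.
  by rewrite x0 lee_fin ms.
rewrite ltxx mulr0 addr0; apply/lee_addgt0Pr => e e0.
(* At this [y], moving the argument from [0] costs at most [e]. *)
pose y := Num.min 1 (e / (`|s| + 1)).
have s0 : 0 <= `|s| by [].
have s1 : 0 < `|s| + 1 by lra.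
have y0 : 0 < y by rewrite /y lt_min ltr01 divr_gt0.
have y1 : y <= 1 by rewrite /y ge_min lexx.
apply: le_trans (leeD (value0_ub generator_decr y0 y1) (lexx e%:E)).
rewrite -EFinD lee_fin; have := ms _ y0.
have : `|s| * y <= e.
  have : y * (`|s| + 1) <= e by rewrite -ler_pdivlMr// /y ge_min lexx orbT.
  lra.
have : - (`|s| * y) <= s * y.
  rewrite -mulNr ler_wpM2r ?(ltW y0)//.
  by have := ler_norm (- s); rewrite normrN; lra.
lra.
Qed.

Lemma generator_continuous (x : R) : 0 < x -> {for x, continuous f}.
Proof.
move=> x0; apply: differentiable_continuous; apply/derivable1_diffP.
exact: (f_C1 x0).1.
Qed.

Lemma extend0_measurable : measurable_fun setT (extend0 f).
Proof.
apply: measurable_fun_if => //.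
- exact: measurable_fun_ltr.
- apply/measurable_EFinP; rewrite setTI (_ : _ @^-1` _ = `]0, +oo[%classic).
    apply: open_continuous_measurable_fun; first exact: interval_open.
    by move=> x; rewrite inE/= in_itv/= andbT; exact: generator_continuous.
  by apply/seteqP; split => x/=; rewrite in_itv/= andbT.
Qed.

End divergence_generator.

(** * Densities and bounds on the divergence *)

Lemma probability_of_density d (T : measurableType d) (R : realType)
    (Q : probability T R) (h : T -> \bar R) :
  measurable_fun setT h -> (forall x, 0 <= h x)%E ->
  (\int[Q]_x h x = 1)%E ->
  exists2 P : probability T R, P `<< Q &
    forall E, measurable E -> (P E = \int[Q]_(x in E) h x)%E.
Proof.
move=> mh h0 h1.
pose m0 := fun E : set T => (\int[Q]_(x in E) h x)%E.
have m00 : m0 set0 = 0%E by rewrite /m0 integral_set0.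
have m0_ge0 E : (0 <= m0 E)%E by exact: integral_ge0.
have m0_add : semi_sigma_additive m0 by exact: semi_sigma_additive_nng_induced.
pose mM : {measure set T -> \bar R} :=
  HB.pack m0 (isMeasure.Build _ _ _ m0 m00 m0_ge0 m0_add).
pose P : probability T R :=
  HB.pack m0 mM (Measure_isProbability.Build _ _ _ mM h1).
exists P => //.
apply/null_content_dominatesP => E mE QE0.
by apply: null_set_integral => //; exact: measurable_funTS.
Qed.

(** Densities are unique almost everywhere, so any of them computes the
    divergence: an explicit one, or one that is nonnegative everywhere where the
    Radon-Nikodym derivative may be negative on a null set. *)
Lemma f_divergence_density d (T : measurableType d) (R : realType)
    (P Q : probability T R) (f : R -> R) (h : T -> \bar R) :
  measurable_fun setT (extend0 f) ->
  P `<< Q -> Q.-integrable setT h ->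
  (forall E, measurable E -> (P E = \int[Q]_(x in E) h x)%E) ->
  (f_divergence f P Q = \int[Q]_x extend0 f (fine (h x)))%E.
Proof.
move=> mf PQ ih hE; have mh := measurable_int _ ih.
apply: ae_eq_integral => //.
- apply: (measurableT_comp mf); apply: (measurableT_comp (fine_measurable _)) => //.
- apply: (measurableT_comp mf); exact: measurableT_comp (fine_measurable _) mh.
suff : ae_eq Q setT (Radon_Nikodym (charge_of_finite_measure P) Q) h.
  by apply: filterS => x + _ => /(_ I) ->.
apply: integral_ae_eq => //; first exact: Radon_Nikodym_integrable.
by move=> E _ mE; rewrite -Radon_Nikodym_integral//= hE.
Qed.

Lemma integral_ge_affine d (T : measurableType d) (R : realType)
    (Q : probability T R) (A : set T) (h : T -> \bar R) (F : T -> \bar R)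
    (m s : R) :
  measurable A -> Q.-integrable A h -> measurable_fun A F ->
  (forall x, A x -> 0 <= F x)%E ->
  (forall x, A x -> m%:E + s%:E * h x <= F x)%E ->
  (m%:E * Q A + s%:E * \int[Q]_(x in A) h x <= \int[Q]_(x in A) F x)%E.
Proof.
move=> mA ih mF F0 hF.
(* The upper function need not be integrable, but then its integral is +oo. *)
have [iF|] := eqVneq (\int[Q]_(x in A) F x)%E +oo%E; first by rewrite iF leey.
rewrite -ltey => iF.
have ic : Q.-integrable A (cst m%:E) by exact: finite_measure_integrable_cst.
have is_ : Q.-integrable A (fun x => s%:E * h x)%E by exact: integrableZl.
rewrite -integralZl// -integral_cst// -integralD//.
apply: le_integral => //.
- exact: integrableD.
- apply/integrableP; split => //.
  rewrite (eq_integral F)// => x; rewrite inE => Ax.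
  by rewrite gee0_abs// F0.
- by move=> x; rewrite inE; exact: hF.
Qed.

(** On [A] and on its complement the density integrates to the [P]-measure, so an
    affine minorant of [f] integrates to a quantity that sees [P] only through
    [P A].  With the best tangents this is the data processing inequality for the
    partition of the space into [A] and its complement; free choice of the two
    minorants avoids that optimization. *)
Lemma f_divergence_ge_affine d (T : measurableType d) (R : realType)
    (P Q : probability T R) (f : R -> R) (A : set T) (m1 s1 m2 s2 : R) :
  measurable_fun setT (extend0 f) -> (forall x, 0 <= extend0 f x)%E ->
  (forall x : R, 0 <= x -> ((m1 + s1 * x)%:E <= extend0 f x)%E) ->
  (forall x : R, 0 <= x -> ((m2 + s2 * x)%:E <= extend0 f x)%E) ->
  P `<< Q -> measurable A ->
  ((m1 * fine (Q A) + s1 * fine (P A) +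
    (m2 * (1 - fine (Q A)) + s2 * (1 - fine (P A))))%:E
   <= f_divergence f P Q)%E.
Proof.
move=> mf f0 ms1 ms2 PQ mA.
have [h [h0 hfin ih hE]] := @radon_nikodym_sigma_finite _ _ _ Q P PQ.
have mh := measurable_int _ ih.
rewrite (f_divergence_density mf PQ ih)//.
have mAC := measurableC mA.
have mF : measurable_fun setT (fun x => extend0 f (fine (h x))).
  by apply: (measurableT_comp mf); exact: measurableT_comp (fine_measurable _) mh.
have affE (m s : R) (x : T) :
    ((m + s * fine (h x))%:E = m%:E + s%:E * h x)%E.
  by rewrite EFinD EFinM fineK.
have fh0 x : 0 <= fine (h x) by exact: fine_ge0.
rewrite -(setUv A) ge0_integral_setU//; last 2 first.
- by rewrite setUv.
- by apply/disj_set2P; rewrite setICr.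
have piece (B : set T) (m s : R) : measurable B ->
    (forall x : R, 0 <= x -> ((m + s * x)%:E <= extend0 f x)%E) ->
    (m%:E * Q B + s%:E * P B <= \int[Q]_(x in B) extend0 f (fine (h x)))%E.
  move=> mB ms; rewrite hE//; apply: integral_ge_affine => //.
  - exact: integrableS ih.
  - exact: measurable_funTS.
  - by move=> x _; rewrite -affE ms.
have := piece _ _ _ mAC ms2; have := piece _ _ _ mA ms1.
rewrite !probability_setC//.
have QAf : Q A \is a fin_num by exact: fin_num_measure.
have PAf : P A \is a fin_num by exact: fin_num_measure.
rewrite -(fineK QAf) -(fineK PAf) => H1 H2.
rewrite EFinD; apply: leeD; first by rewrite EFinD !EFinM.
by rewrite EFinD !EFinM !EFinB.
Qed.

(** The density is [q / p] on [A] and [(1 - q) / (1 - p)] outside: conditionally on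
    [A] and on its complement, [P] is the same as [Q]. *)
Lemma two_valued_f_divergence d (T : measurableType d) (R : realType)
    (Q : probability T R) (f : R -> R) (A : set T) (p q : R) :
  measurable_fun setT (extend0 f) -> (forall x, 0 <= extend0 f x)%E ->
  measurable A -> Q A = p%:E -> 0 < p < 1 -> 0 < q < 1 ->
  exists2 P : probability T R, P `<< Q &
    P A = q%:E /\
    f_divergence f P Q = (f (q / p) * p + f ((1 - q) / (1 - p)) * (1 - p))%:E.
Proof.
move=> mf f0 mA QA /andP[p0 p1] /andP[q0 q1].
have mAC := measurableC mA.
have p1' : 0 < 1 - p by rewrite subr_gt0.
have q1' : 0 < 1 - q by rewrite subr_gt0.
pose a := q / p; pose b := (1 - q) / (1 - p).
have a0 : 0 < a by rewrite divr_gt0.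
have b0 : 0 < b by rewrite divr_gt0.
have QAC : Q (~` A) = (1 - p)%:E by rewrite probability_setC// QA.
pose h := fun x : T => (b + (a - b) * \1_A x)%:E.
have mh : measurable_fun setT h.
  apply/measurable_EFinP; apply: measurable_funD => //.
  by apply: measurable_funM => //; exact: measurable_indic.
have int_step (F : R -> \bar R) : measurable_fun setT F ->
    (forall x, 0 <= F x)%E ->
    (\int[Q]_x F (fine (h x)) = F a * p%:E + F b * (1 - p)%:E)%E.
  move=> mF F0.
  rewrite -(setUv A) ge0_integral_setU//; last 2 first.
  - rewrite setUv; apply: (measurableT_comp mF).
    exact: measurableT_comp (fine_measurable _) mh.
  - by apply/disj_set2P; rewrite setICr.
  rewrite -QAC -QA -!integral_cst//; congr (_ + _)%E; apply: eq_integral => x.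
    by rewrite inE => xA; rewrite /h indicE mem_set//= mulr1 addrC subrK.
  by rewrite inE => xA; rewrite /h indicE memNset//= mulr0 addr0.
have h0 x : (0 <= h x)%E.
  rewrite /h lee_fin indicE; case: (x \in A) => /=.
    by rewrite mulr1 addrC subrK ltW.
  by rewrite mulr0 addr0 ltW.
have ma : a * p = q by rewrite divfK// gt_eqF.
have mb : b * (1 - p) = 1 - q by rewrite divfK// gt_eqF.
have h1 : (\int[Q]_x h x = 1)%E.
  (* [int_step] asks for an integrand that is nonnegative on all of [R]. *)
  transitivity (\int[Q]_x (`|fine (h x)|)%:E)%E.
    by apply: eq_integral => x _; rewrite ger0_norm ?fine_ge0.
  rewrite (int_step (fun x => `|x|%:E)) ?gtr0_norm//.
  - by rewrite -!EFinM -EFinD ma mb; rewrite addrC subrK.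
  - by apply/measurable_EFinP; exact: normr_measurable.
have [P PQ hE] := probability_of_density mh h0 h1.
exists P => //; split.
  rewrite hE// (eq_integral (cst a%:E)) => [|x].
    by rewrite integral_cst//= QA -EFinM ma.
  by rewrite inE => xA; rewrite /h indicE mem_set//= mulr1 addrC subrK.
rewrite (f_divergence_density mf PQ _ hE) ?int_step//.
  by rewrite /extend0 a0 b0.
apply/integrableP; split => //.
by under eq_integral do rewrite gee0_abs//; rewrite h1 ltry.
Qed.

(** * Bounds on the worst tail *)

Section tails.
Context (R : realType).
Implicit Types (Q P : probability (nonneg_ereal R) R) (f : R -> R).

Definition upper_set (x : R) : set (nonneg_ereal R) :=
  [set y | (x%:E < nonneg_ereal_val y < +oo)%E].

Lemma measurable_upper_set x : measurable (upper_set x).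
Proof.
exists [set` Interval (BRight x%:E) (BLeft +oo%E)]; first exact: emeasurable_itv.
by apply/seteqP; split => y; rewrite setTI /= in_itv/=.
Qed.

Lemma tail_itv P x : 0 <= tail P x <= 1.
Proof.
have mx := measurable_upper_set x.
rewrite /tail fine_ge0//= -lee_fin fineK ?fin_num_measure//.
exact: probability_le1.
Qed.

Lemma le_worst_tail f Q delta P x :
  P `<< Q -> (f_divergence f P Q <= delta%:E)%E ->
  tail P x <= worst_tail f Q delta x.
Proof.
move=> PQ D; apply: ub_le_sup; last by exists P.
by exists 1 => _ [P' _ <-]; have /andP[] := tail_itv P' x.
Qed.

Lemma worst_tail_le f Q delta x (u : R) : 0 <= u ->
  (forall P, P `<< Q -> (f_divergence f P Q <= delta%:E)%E -> tail P x <= u) ->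
  worst_tail f Q delta x <= u.
Proof.
move=> u0 H; rewrite /worst_tail.
(* An empty ball gives [worst_tail] the default value [0]; hence [0 <= u]. *)
have [->|/set0P ne] := eqVneq [set tail P x | P in f_ball f Q delta] set0.
  by rewrite sup0.
by apply: ge_sup => // _ [P [PQ D] <-]; exact: H.
Qed.

End tails.

Section bounds.
Context (R : realType) (f : R -> R) (Q : probability (nonneg_ereal R) R).
Hypotheses (f_strict : strictly_convex_pos f) (f1 : f 1 = 0).
Hypotheses (f_C1 : continuously_derivable_pos f) (df1 : derive1 f 1 = 0).

(** Weakens the exact condition that the two-valued density lies in the ball: as
    [f] decreases on [(0, 1]] and is nonnegative, the share
    [(1-p) f((1-q)/(1-p))] of the complement is at most [f(1-q)], which does not
    depend on [p]. *)
Lemma worst_tail_ge (delta x q : R) :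
  let p := tail Q x in
  0 < p -> p <= q -> q < 1 -> p * f (q / p) + f (1 - q) <= delta ->
  q <= worst_tail f Q delta x.
Proof.
move=> p p0 pq q1 D.
have mx := measurable_upper_set x.
have Qx : Q (upper_set x) = p%:E by rewrite fineK// fin_num_measure.
have [||||||P PQ [Pq PD]] := @two_valued_f_divergence _ _ _ Q f (upper_set x) p q.
- exact: extend0_measurable.
- exact: extend0_ge0.
- exact: mx.
- exact: Qx.
- by rewrite p0/=; lra.
- by rewrite q1 andbT; lra.
have <- : tail P x = q by rewrite /tail -/(upper_set x) Pq.
apply: le_worst_tail => //; rewrite PD lee_fin mulrC; apply: le_trans D.
rewrite lerD2l.
have p1 : 0 < 1 - p by lra.
have A : 1 - q <= (1 - q) / (1 - p) by rewrite ler_pdivlMr// ler_piMr//; lra.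
have B : (1 - q) / (1 - p) <= 1 by rewrite ler_pdivrMr//; lra.
have C : f ((1 - q) / (1 - p)) <= f (1 - q) by apply: generator_decr => //; lra.
apply: le_trans C; rewrite ler_piMr//; last lra.
by apply: generator_ge0 => //; rewrite divr_gt0//; lra.
Qed.

Lemma ball_tail_affine (delta x m1 s1 m2 s2 : R)
    (P : probability (nonneg_ereal R) R) :
  (forall y : R, 0 < y -> m1 + s1 * y <= f y) ->
  (forall y : R, 0 < y -> m2 + s2 * y <= f y) ->
  P `<< Q -> (f_divergence f P Q <= delta%:E)%E ->
  m1 * tail Q x + s1 * tail P x + (m2 * (1 - tail Q x) + s2 * (1 - tail P x))
    <= delta.
Proof.
move=> ms1 ms2 PQ; rewrite -lee_fin; apply: le_trans.
apply: (@f_divergence_ge_affine _ _ _ P Q f (upper_set x)) => //.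
- exact: extend0_measurable.
- exact: extend0_ge0.
- exact: extend0_ge_affine.
- exact: extend0_ge_affine.
- exact: measurable_upper_set.
Qed.

End bounds.

(** * Asymptotics of the worst tail *)

Lemma asymp_of_bounds (R : realType) (W g : R -> R) :
  (forall e : R, 0 < e -> e < 1 -> \forall x \near +oo,
     [/\ 0 < g x, (1 - e) * g x <= W x & W x <= (1 + e) * g x]) ->
  asymp W g.
Proof.
move=> H; apply/cvgrPdist_le => e e0; near=> x.
pose d := Num.min e (1 / 2).
have [g0 lo hi] : [/\ 0 < g x, (1 - d) * g x <= W x & W x <= (1 + d) * g x].
  near: x; apply: H; first by rewrite /d lt_min e0/= divr_gt0.
  by rewrite /d gt_min; apply/orP; right; lra.
have de : d <= e by rewrite /d ge_min lexx.
rewrite distrC ler_distl; apply/andP; split.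
  rewrite ler_pdivlMr//; apply: le_trans lo; rewrite ler_wpM2r ?(ltW g0)//; lra.
rewrite ler_pdivrMr//; apply: (le_trans hi); rewrite ler_wpM2r ?(ltW g0)//; lra.
Unshelve. all: by end_near. Qed.

Lemma tail_near (R : realType) (Q : probability (nonneg_ereal R) R) (x0 : R) :
  (forall x, x0 <= x -> 0 < tail Q x) -> tail Q x @[x --> +oo] --> (0 : R) ->
  forall e : R, 0 < e -> \forall x \near +oo, 0 < tail Q x /\ tail Q x < e.
Proof.
move=> t0 /cvgrPdist_lt tc e e0; near=> x.
have tx : 0 < tail Q x by apply: t0; near: x; apply: nbhs_pinfty_ge; exact: num_real.
split => //; have : `|0 - tail Q x| < e by near: x; exact: tc.
by rewrite sub0r normrN gtr0_norm.
Unshelve. all: by end_near. Qed.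

Section asymptotics.
Context (R : realType) (f : R -> R).
Hypotheses (f_strict : strictly_convex_pos f) (f1 : f 1 = 0).
Hypotheses (f_C1 : continuously_derivable_pos f) (df1 : derive1 f 1 = 0).

Lemma generator_within (a b : R) : 0 < a -> {within `[a, b], continuous f}.
Proof.
move=> a0; apply: derivable_within_continuous => x.
rewrite in_itv/= => /andP[ax _]; apply: (f_C1 _).1; exact: lt_le_trans ax.
Qed.

(** By continuity the level [y] is attained, and by strict monotonicity it is
    attained at the infimum. *)
Lemma generalized_inverseP (y w : R) : 0 < y -> 1 <= w -> y <= f w ->
  1 < generalized_inverse f y /\ f (generalized_inverse f y) = y.
Proof.
move=> y0 w1 yw.
have [z /andP[z1 zw] fz] : exists2 z, 1 <= z <= w & f z = y.
  have [|z] := IVT w1 (@generator_within 1 w ltr01) (v := y).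
    by rewrite f1 ge_min (ltW y0) le_max yw orbT.
  by rewrite in_itv/=; exists z.
have z1' : 1 < z.
  rewrite lt_neqAle z1 andbT; apply/eqP => E.
  by move: y0; rewrite -fz -E f1 ltxx.
suff -> : generalized_inverse f y = z by [].
apply/eqP; rewrite eq_le; apply/andP; split.
  apply: inf_lbound; last by split => //; rewrite fz.
  by exists 1 => u [].
apply: lb_le_inf; first by exists w.
move=> u [u1 yu]; rewrite leNgt; apply/negP => uz.
have := generator_incr_strict f_strict f1 u1 uz; rewrite fz => /(_ y0); lra.
Qed.

(** With [z] the generalized inverse of [f] at [delta / p], the worst tail lies
    between [(1 - e) z p] and [z p].  That [z p] tends to [0] is where the infinite
    slope enters: [z p = delta z / f z]. *)
Lemma worst_tail_infinite_slope (Q : probability (nonneg_ereal R) R)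
    (x0 delta : R) :
  (forall x, x0 <= x -> 0 < tail Q x) -> tail Q x @[x --> +oo] --> (0 : R) ->
  0 < delta -> value0 (star_conjugate f) = +oo%E ->
  asymp (worst_tail f Q delta)
    (fun x => generalized_inverse f (delta / tail Q x) * tail Q x).
Proof.
move=> t0 tc d0 fs; apply: asymp_of_bounds => e e0 e1.
have ed0 : 0 < e * delta by rewrite mulr_gt0.
have [eta eta0 etaP] : exists2 eta : R, 0 < eta < 1 &
    forall u : R, 0 <= u <= eta -> f (1 - u) <= e * delta.
  have /cvgrPdist_lt/(_ _ ed0) := generator_continuous f_C1 ltr01.
  rewrite f1 => -[r /= r0 rP].
  exists (Num.min (r / 2) (1 / 2)).
    by rewrite lt_min gt_min; apply/andP; split; [lra|apply/orP; right; lra].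
  move=> u /andP[u0]; rewrite le_min => /andP[ur u1].
  have : ball (1:R) r (1 - u) by rewrite /ball/= opprB addrC subrK ger0_norm//; lra.
  move=> /rP /=; rewrite sub0r normrN => H; apply: ltW; apply: le_lt_trans H.
  exact: ler_norm.
have slope (r : R) : exists2 z, 1 <= z & forall w, z <= w -> r * w < f w.
  by apply: generator_slope_gt => //; rewrite fs ltry.
have [eta_gt0 eta_lt1] := andP eta0.
(* Beyond [zr] the slope of [f] exceeds [delta / eta], which makes [p * z] at most
   [eta]; a small [p] pushes [z] beyond [zr]. *)
have [zr zr1 zrP] := slope (delta / eta).
have fzr : 0 <= f zr by apply: generator_ge0 => //; lra.
near=> x.
have [p0 pe] : 0 < tail Q x /\ tail Q x < delta / (f zr + 1).
  near: x; apply: tail_near t0 tc _ _; rewrite divr_gt0//; lra.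
set p := tail Q x in p0 pe *.
have y0 : 0 < delta / p by rewrite divr_gt0.
have [w w1 wP] := slope (delta / p).
have yw : delta / p <= f w.
  by apply: le_trans (ltW (wP _ (lexx w))); rewrite ler_peMr// ltW.
have [] := generalized_inverseP y0 w1 yw.
set z := generalized_inverse f (delta / p) => z1 fz.
have z0 : 0 < z by lra.
have pfz : p * f z = delta by rewrite fz mulrC divfK// gt_eqF.
have zrz : zr <= z.
  rewrite leNgt; apply/negP => zzr.
  have H : f z <= f zr.
    by apply: generator_incr => //; exact: ltW.
  move: pe; rewrite ltr_pdivlMr; last by lra.
  by rewrite -pfz ltr_pM2l//; lra.
have pz : p * z <= eta.
  have := zrP _ zrz; rewrite mulrAC ltr_pdivrMr// => H.
  have : delta * (p * z) < delta * eta.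
    rewrite mulrCA -[in X in _ < X]pfz -mulrA ltr_pM2l//.
  by rewrite ltr_pM2l// => /ltW.
split; first by rewrite mulr_gt0.
- have e1' : 0 <= 1 - e <= 1 by lra.
  (* Mixing [z] with [1] multiplies the bound [delta] on [p * f z] by [1 - e], and
     the rest [e * delta] covers [f (1 - q)]. *)
  pose q := p * ((1 - e) * z + (1 - (1 - e)) * 1).
  have pq : p <= q.
    rewrite /q ler_peMr ?(ltW p0)//.
    have : (1 - e) * 1 <= (1 - e) * z by rewrite ler_wpM2l//; lra.
    lra.
  have qz : q <= p * z.
    rewrite /q ler_pM2l//.
    have : e * 1 <= e * z by rewrite ler_wpM2l//; lra.
    lra.
  apply: (@le_trans _ _ q).
    rewrite /q mulrA mulrC ler_pM2l//; lra.
  apply: worst_tail_ge => //; first lra.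
  have -> : q / p = (1 - e) * z + (1 - (1 - e)) * 1.
    by rewrite /q mulrC mulKf// gt_eqF.
  have A := convex_of_strict f_strict z0 ltr01 e1'.
  have B : f (1 - q) <= e * delta by apply: etaP; lra.
  have : p * f ((1 - e) * z + (1 - (1 - e)) * 1) <= (1 - e) * delta.
    rewrite -[in leRHS]pfz mulrCA ler_pM2l//; apply: le_trans A _.
    by rewrite f1 mulr0 addr0.
  rewrite -/p; lra.
- have zp0 : 0 < z * p by rewrite mulr_gt0.
  apply: (@le_trans _ _ (z * p)); last by rewrite ler_peMl// ?ltW//; lra.
  apply: worst_tail_le => [|P PQ D]; first exact: ltW.
  (* Tangent at [z] on the tail, minorant [0] elsewhere: since [p * f z = delta],
     the bound reads [f'(z) * (q - p * z) <= 0]. *)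
  have s0 : 0 < derive1 f z.
    have := generator_tangent f_strict f_C1 z0 ltr01; rewrite f1 fz => H.
    have : 0 < derive1 f z * (z - 1) by lra.
    by rewrite pmulr_lgt0//; lra.
  have := @ball_tail_affine _ f Q f_strict f1 f_C1 df1 delta x
    (f z - derive1 f z * z) (derive1 f z) 0 0 P _ _ PQ D.
  rewrite -/p => H.
  have {}H : (f z - derive1 f z * z) * p + derive1 f z * tail P x <= delta.
    rewrite !mul0r !addr0 in H; apply: H => y yy.
      by have := generator_tangent f_strict f_C1 z0 yy; lra.
    by rewrite mul0r addr0; exact: generator_ge0.
  have : derive1 f z * tail P x <= derive1 f z * (z * p) by lra.
  by rewrite ler_pM2l.
Unshelve. all: by end_near. Qed.

(** The left-hand side of the equation vanishes at [0] and exceeds [delta] near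
    [1], by the bound on [delta]; the root is kept away from [1], where [f(1 - l)]
    would be [f(0)]. *)
Lemma tail_share_root (c delta : R) :
  value0 (star_conjugate f) = c%:E -> 0 < c -> 0 < delta ->
  (delta%:E < c%:E + value0 f)%E ->
  exists2 l : R, 0 < l < 1 & l * c + f (1 - l) = delta.
Proof.
move=> fs c0 d0 dlt.
have : ((delta - c)%:E < value0 f)%E by rewrite EFinB lteBlDl.
move=> /(value0_gt (generator_decr f_strict f1 f_C1 df1))[y0 [y0_gt0 y0_le1]].
rewrite lte_fin => fy0.
(* Small enough that stopping at [1 - y] loses no more than the excess of [f y0]
   over [delta - c]. *)
pose y := Num.min y0 ((f y0 - delta + c) / c).
have y_gt0 : 0 < y by rewrite lt_min y0_gt0 divr_gt0//; lra.
have yy0 : y <= y0 by rewrite ge_min lexx.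
have yc : y * c <= f y0 - delta + c.
  by rewrite -ler_pdivlMr// ge_min lexx orbT.
have fy : f y0 <= f y by apply: generator_decr.
pose g (t : R) := t * c + f (1 - t).
have gc : {within `[0, 1 - y], continuous g}.
  apply: derivable_within_continuous => t; rewrite in_itv/= => /andP[_ ty].
  apply: derivableD; first exact: derivableM.
  apply/derivable1_diffP; apply: differentiable_comp.
    by apply: differentiableB.
  by apply/derivable1_diffP; apply: (f_C1 _).1; lra.
have y1 : 0 <= 1 - y by lra.
have g0 : g 0 = 0 by rewrite /g mul0r add0r subr0.
have g1 : delta <= g (1 - y).
  by rewrite /g (_ : 1 - (1 - y) = y); [clear fs dlt; lra|ring].
have [|l] := IVT y1 gc (v := delta).
  by rewrite g0 ge_min le_max (ltW d0) g1 orbT.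
rewrite in_itv/= => /andP[l0 ly] gl.
exists l => //; apply/andP; split; last lra.
rewrite lt_neqAle l0 andbT; apply/eqP => E.
by move: d0; rewrite -gl -E g0 ltxx.
Qed.

(** The mass [l] is reached as soon as [p < l].  In the other direction, a tangent
    whose slope is at least [c - eta] on the tail and the tangent at [1 - l]
    elsewhere give [c (q - l) <= K p + eta] for every [q] above [l] that is
    reached, and [eta] is half of the margin [c * (e * l)]. *)
Lemma worst_tail_finite_slope (Q : probability (nonneg_ereal R) R)
    (x0 delta c l : R) :
  (forall x, x0 <= x -> 0 < tail Q x) -> tail Q x @[x --> +oo] --> (0 : R) ->
  value0 (star_conjugate f) = c%:E -> 0 < c ->
  0 < l < 1 -> l * c + f (1 - l) = delta ->
  asymp (worst_tail f Q delta) (fun=> l).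
Proof.
move=> t0 tc fs c0 /andP[l0 l1] lE; apply: asymp_of_bounds => e e0 e1.
have el0 : 0 < e * l by rewrite mulr_gt0.
pose eta := c * (e * l) / 2.
have eta0 : 0 < eta by rewrite /eta divr_gt0// mulr_gt0.
have eta_lt_c : eta < c.
  have el : e * l < e * 1 by rewrite ltr_pM2l.
  have : c * (e * l) < c * 1 by rewrite ltr_pM2l//; lra.
  rewrite /eta; lra.
have [a0 a01 a0P] : exists2 z, 1 <= z & forall w, z <= w -> (c - eta) * w < f w.
  by apply: generator_slope_gt => //; rewrite fs lte_fin; lra.
(* [a] is kept above [1], so that the tangent at [a], compared with [f] at [1], has
   slope at least [f a / (a - 1)]. *)
pose a := a0 + 1.
have a_gt0 : 0 < a by rewrite /a; lra.
have fa : (c - eta) * a < f a by apply: a0P; rewrite /a; lra.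
have sa : c - eta <= derive1 f a.
  have a1 : 0 < a - 1 by rewrite /a; lra.
  rewrite -(ler_pM2r a1).
  have := generator_tangent f_strict f_C1 a_gt0 ltr01; rewrite f1.
  lra.
pose b := 1 - l.
have b0 : 0 < b by rewrite /b; lra.
pose s := derive1 f b.
have s0 : s <= 0.
  have := generator_tangent f_strict f_C1 b0 ltr01; rewrite f1.
  have := generator_ge0 f_strict f1 f_C1 df1 b0 => A B.
  have : s * (1 - b) <= 0 by rewrite /s; lra.
  by rewrite pmulr_lle0// /b; lra.
pose m1 := f a - derive1 f a * a.
pose m2 := f b - s * b.
pose K := `|m1| + `|m2|.
have K0 : 0 <= K by rewrite addr_ge0.
near=> x.
have [p0 pl] : 0 < tail Q x /\ tail Q x < l.
  by near: x; exact: tail_near t0 tc _ _.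
have [_ pe] : 0 < tail Q x /\ tail Q x < eta / (K + 1).
  near: x; apply: tail_near t0 tc _ _; rewrite divr_gt0//; lra.
set p := tail Q x in p0 pl pe *.
split => //.
- apply: (@le_trans _ _ l); first by rewrite ler_piMl// ?ltW//; lra.
  apply: worst_tail_ge => //; first exact: ltW.
  have lp : 1 <= l / p by rewrite ler_pdivlMr// mul1r ltW.
  have : p * f (l / p) <= p * (c * (l / p)).
    by rewrite ler_pM2l//; exact: generator_le_slope.
  have -> : p * (c * (l / p)) = l * c.
    by rewrite mulrCA (mulrC p) divfK ?gt_eqF// mulrC.
  rewrite -/p; lra.
- apply: worst_tail_le => [|P PQ D]; first by rewrite mulr_ge0//; lra.
  have [ql|ql] := leP (tail P x) l; first by apply: le_trans ql _; lra.
  have T1 (y : R) : 0 < y -> m1 + derive1 f a * y <= f y.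
    by move=> y0; have := generator_tangent f_strict f_C1 a_gt0 y0; rewrite /m1; lra.
  have T2 (y : R) : 0 < y -> m2 + s * y <= f y.
    by move=> y0; have := generator_tangent f_strict f_C1 b0 y0; rewrite /m2 /s; lra.
  have := ball_tail_affine f_strict f1 f_C1 df1 x T1 T2 PQ D.
  rewrite -/p; have /andP[q0 q1] := tail_itv P x.
  move: q0 q1 ql; set q := tail P x => q0 q1 ql H.
  have pK : p * (K + 1) < eta by rewrite -ltr_pdivlMr//; lra.
  have A1 : - (`|m1| * p) <= m1 * p.
    by rewrite -mulNr ler_pM2r//; have := ler_norm (- m1); rewrite normrN; lra.
  have A2 : m2 * p <= `|m2| * p by rewrite ler_pM2r// ler_norm.
  have A3 : (c - eta) * q <= derive1 f a * q by rewrite ler_wpM2r.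
  have A4 : eta * q <= eta * 1 by rewrite ler_pM2l.
  have A5 : 0 <= - s * (q - l) by rewrite mulr_ge0//; lra.
  have B : m2 + s * (1 - q) = f (1 - l) + s * (l - q) by rewrite /m2 /b; ring.
  have C : K * p = `|m1| * p + `|m2| * p by rewrite /K mulrDl.
  have : c * (q - l) <= c * (e * l).
    have -> : c * (e * l) = eta + eta by rewrite /eta; field.
    clearbody eta K m1 m2 s; lra.
  by rewrite ler_pM2l//; lra.
Unshelve. all: by end_near. Qed.

End asymptotics.

Theorem proposition3p3 (R : realType)
    (Phat : probability (nonneg_ereal R) R) (x0 : R)
    (x0_ge0 : 0 <= x0)
    (tail_gt0 : forall x, x0 <= x -> 0 < tail Phat x)
    (tail_cvg0 : tail Phat x @[x --> +oo] --> (0 : R))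
    (f : R -> R)
    (f_convex : convex_function (`]0, +oo[ : set R) f)
    (f1 : f 1 = 0)
    (f_C1 : continuously_derivable_pos f)
    (f_strict : strictly_convex_pos f)
    (df1 : derive1 f 1 = 0)
    (f_ge0 : forall x, 1 <= x -> 0 <= f x)
    (f_incr : forall x y, 1 <= x -> x <= y -> f x <= f y)
    (rho : R) (rho_ge1 : 1 <= rho)
    (f_rv : regularly_varying f rho)
    (delta : R) (delta_gt0 : 0 < delta)
    (delta_lt : (delta%:E < value0 (star_conjugate f) + value0 f)%E) :
  (value0 (star_conjugate f) = +oo%E ->
     asymp (worst_tail f Phat delta)
       (fun x => generalized_inverse f (delta / tail Phat x) * tail Phat x)) /\
  ((0 < value0 (star_conjugate f) < +oo)%E ->
     exists l : R,
       [/\ 0 < l <= 1,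
           (l%:E * value0 (star_conjugate f) + extend0 f (1 - l) = delta%:E)%E,
           forall l' : R, l' <= 1 ->
             (l'%:E * value0 (star_conjugate f) + extend0 f (1 - l')
                = delta%:E)%E -> l' = l
         & asymp (worst_tail f Phat delta) (fun=> l)]).
Proof.
split => [fs|/andP[c0 cfin]].
  exact: worst_tail_infinite_slope tail_gt0 tail_cvg0 _ _.
have cf : value0 (star_conjugate f) \is a fin_num by rewrite gt0_fin_numE.
have := fineK cf => /esym fs.
move: c0 delta_lt fs; clear cfin cf.
set c := fine _ => c0 dlt fs; move: c0 dlt; rewrite fs lte_fin => c0 dlt.
have [l l01 lE] := tail_share_root f_strict f1 f_C1 df1 fs c0 delta_gt0 dlt.
have /andP[l0 l1] := l01.
exists l; split.
- by rewrite l0 ltW.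
- by rewrite /extend0 subr_gt0 l1 -EFinM -EFinD lE.
- move=> l'; rewrite le_eqVlt => /predU1P[->|l'1].
    by rewrite mul1e subrr /extend0 ltxx => E; move: dlt; rewrite E ltxx.
  rewrite /extend0 subr_gt0 l'1 -EFinM -EFinD => -[E].
  (* On [(0, 1)] the left-hand side is strictly increasing; a nonpositive [l'] gives
     a nonpositive value. *)
  have mono (u v : R) : 0 < u -> u < v -> v < 1 ->
      u * c + f (1 - u) < v * c + f (1 - v).
    move=> u0 uv v1; have : u * c < v * c by rewrite ltr_pM2r.
    have : f (1 - u) <= f (1 - v) by apply: generator_decr => //; lra.
    lra.
  have [l'0|l'0] := leP l' 0.
    have : f (1 - l') <= c * (1 - l' - 1) by apply: generator_le_slope_sub1 => //; lra.
    by clear dlt fs; lra.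
  have [ll|ll|//] := ltgtP l' l.
    by have := mono _ _ l'0 ll l1; clear dlt fs; lra.
  by have := mono _ _ l0 ll l'1; clear dlt fs; lra.
- exact: worst_tail_finite_slope tail_gt0 tail_cvg0 fs c0 l01 lE.
Qed.
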